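(* Let $\boldsymbol\lambda,\boldsymbol\mu,\boldsymbol\nu\in\mathcal{P}(\Phi)$ with $\|\boldsymbol\nu\|=\|\boldsymbol\lambda\|+\|\boldsymbol\mu\|$. Then the structure constant $a^{\boldsymbol\nu}_{\boldsymbol\lambda\boldsymbol\mu}(n)$ (defined for all $n\ge \|\boldsymbol\nu\|+\ell(\boldsymbol\nu^e)$) is a nonnegative integer which is independent of $n$.
   Context: Let $q$ be a prime power, $\mathbb F_q$ the field with $q$ elements, and $G_n=GL_n(\mathbb F_q)$. For $m\le n$ regard $G_m\subset G_n$ via $g\mapsto \mathrm{diag}(g,I_{n-m})$. Let $\Phi$ be the set of monic irreducible polynomials in $\mathbb F_q[t]$ other than $t$, and $d(f)$ the degree of $f$. Let $\mathcal{P}(\Phi)$ be the set of maps $\boldsymbol\lambda$ from $\Phi$ to the set of integer partitions with $\boldsymbol\lambda(f)=\emptyset$ for all but finitely many $f$; put $\|\boldsymbol\lambda\|=\sum_f d(f)|\boldsymbol\lambda(f)|$, $\boldsymbol\lambda^e:=\boldsymbol\lambda(t-1)$, and let $\ell(\cdot)$ denote the number of nonzero parts of a partition. The type of $g\in G_n$ is the unique $\boldsymbol\lambda\in\mathcal{P}(\Phi)$ such that $\mathbb F_q^n$, viewed as an $\mathbb F_q[t]$-module with $t$ acting by $g$, is isomorphic to $\bigoplus_{f,i}\mathbb F_q[t]/(f^{\boldsymbol\lambda_i(f)})$, where $\boldsymbol\lambda(f)=(\boldsymbol\lambda_1(f),\boldsymbol\lambda_2(f),\dots)$. The modified type of $g$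 is $\mathring{\boldsymbol\lambda}\in\mathcal{P}(\Phi)$ with $\mathring{\boldsymbol\lambda}(f)=\boldsymbol\lambda(f)$ for $f\ne t-1$ and $\mathring{\boldsymbol\lambda}(t-1)=(\boldsymbol\lambda^e_1-1,\dots,\boldsymbol\lambda^e_r-1)$ (zero parts discarded), $r=\ell(\boldsymbol\lambda^e)$; it does not change under the embeddings $G_n\subset G_{n+m}$. Elements of $G_n$ of modified type $\boldsymbol\mu$ exist iff $\|\boldsymbol\mu\|+\ell(\boldsymbol\mu^e)\le n$, and then they form one conjugacy class. Let $K_{\boldsymbol\mu}(n)\in\mathbb Z[G_n]$ be the sum of all elements of $G_n$ of modified type $\boldsymbol\mu$ (zero if there are none). The nonzero $K_{\boldsymbol\mu}(n)$ form a $\mathbb Z$-basis of the center of $\mathbb Z[G_n]$, and the structure constants $a^{\boldsymbol\nu}_{\boldsymbol\lambda\boldsymbol\mu}(n)$, for $\boldsymbol\nu$ with $\|\boldsymbol\nu\|+\ell(\boldsymbol\nu^e)\le n$, are defined by $K_{\boldsymbol\lambda}(n)K_{\boldsymbol\mu}(n)=\sum_{\boldsymbol\nu}a^{\boldsymbol\nu}_{\boldsymbol\lambda\boldsymbol\mu}(n)K_{\boldsymbol\nu}(n)$. *)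

(* Defs.v *)
From HB Require Import structures.
From mathcomp Require Import all_boot all_order all_algebra.
From mathcomp Require Import finmap.
From mathcomp Require Import boolp.
Set Implicit Arguments.
Unset Strict Implicit.
Unset Printing Implicit Defensive.
Import GRing.Theory.
Local Open Scope ring_scope.

Section Types.
Variable F : finFieldType.

(* Maps from polynomials to integer partitions (seq nat), with finite support:
   an element of P(Phi) once [is_mpart] holds. *)
Definition mpart := {fsfun {poly F} -> seq nat with [::]}.

Definition inPhi (f : {poly F}) : Prop :=
  [/\ f \is monic, irreducible_poly f & f != 'X].

Definition is_partition (s : seq nat) : bool :=
  sorted geq s && all (fun k => 0 < k)%N s.

Definition is_mpart (lam : mpart) : Prop :=
  forall f : {poly F}, is_partition (lam f) /\ (lam f != [::] -> inPhi f).

Definition pdeg (f : {poly F}) : nat := (size f).-1.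

Definition mnorm (lam : mpart) : nat :=
  (\sum_(f <- finsupp lam) pdeg f * sumn (lam f))%N.

Definition epart (lam : mpart) : seq nat := lam ('X - 1).

(* The list of the polynomials f^(lam_i(f)), one per summand of
   (+)_{f,i} F[t]/(f^(lam_i(f))). *)
Definition eldiv (lam : mpart) : seq {poly F} :=
  flatten [seq [seq f ^+ k | k <- lam f] | f <- finsupp lam].

(* g has type lam: F^n (column vectors, t acting by g) is isomorphic as an
   F[t]-module to (+)_i F[t]/(p_i), p_i ranging over [eldiv lam]; the summand
   F[t]/(p) is modelled by the remainders modulo p (polynomials of size < size p),
   on which t acts by r |-> t*r mod p. *)
Definition has_type (n : nat) (g : 'M[F]_n) (lam : mpart) : Prop :=
  let ps := eldiv lam in
  exists phi : 'cV[F]_n -> 'I_(size ps) -> {poly F},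
  [/\ (forall (a : F) (u v : 'cV[F]_n) i,
          phi (a *: u + v) i = a *: phi u i + phi v i),
      (forall u v, (forall i, phi u i = phi v i) -> u = v),
      (forall v i, size (phi v i) < size (nth 0%R ps i))%N,
      (forall w : 'I_(size ps) -> {poly F},
          (forall i, size (w i) < size (nth 0%R ps i))%N ->
          exists v, forall i, phi v i = w i)
    & (forall v i, phi (g *m v) i = ('X * phi v i) %% nth 0%R ps i)].

Definition has_modtype (n : nat) (g : 'M[F]_n) (mu : mpart) : Prop :=
  exists lam : mpart,
  [/\ is_mpart lam, has_type g lam,
      (forall f, f != 'X - 1 -> mu f = lam f)
    & mu ('X - 1) = [seq k.-1 | k <- lam ('X - 1) & (1 < k)%N]].

(* Elements of Z[G_n] are modelled as int-valued functions on n x n matrices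
   supported on the invertible ones; K_mu(n) is the class sum. *)
Definition classsum (n : nat) (mu : mpart) : {ffun 'M[F]_n -> int} :=
  [ffun g => ((g \in unitmx) && `[< has_modtype g mu >])%:R].

Definition galg_mul (n : nat) (X Y : {ffun 'M[F]_n -> int}) : {ffun 'M[F]_n -> int} :=
  [ffun z => \sum_(x : 'M[F]_n | x \in unitmx) X x * Y (invmx x *m z)].

(* Structure constant a^nu_{lam mu}(n) read off at an element z of modified
   type nu: since the K_nu(n) have pairwise disjoint supports, the coefficient
   of K_nu(n) in K_lam(n) K_mu(n) is its value at any element of that class. *)
Definition coeff_at (n : nat) (lam mu : mpart) (z : 'M[F]_n) : int :=
  galg_mul (classsum n lam) (classsum n mu) z.

End Types.

(* Main.v *)
Require Import Defs.
From HB Require Import structures.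
From mathcomp Require Import all_boot all_order all_algebra all_fingroup.
From mathcomp Require Import finfield mxabelem.
From mathcomp Require Import finmap.
From mathcomp Require Import boolp.
Set Implicit Arguments.
Unset Strict Implicit.
Unset Printing Implicit Defensive.
Import GRing.Theory.
Local Open Scope ring_scope.

(* The norm of the modified type of g is rank(g - 1).  Hence, when the norms add
   up and z = x y, we have rank(z - 1) = rank(x - 1) + rank(y - 1), which forces
   im(x - 1) to lie in im(z - 1) and ker(z - 1) to lie in ker(x - 1).  So every
   factorization of diag(z, 1) is of the form diag(x, 1) diag(y, 1): since modified
   types are stable, z and diag(z, 1) have the same number of factorizations.
   Two matrices of the same modified type become similar after enlarging one of
   them by an identity block. *)

(** * Module isomorphisms F^n = (+)_i F[t]/(p_i) *)

Section ModuleIso.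
Variable F : finFieldType.
Implicit Types (p q : {poly F}).

(** The index type is arbitrary, so that a summand can be added or removed through [option I]
    without renumbering a list. *)
Definition module_iso (I : Type) (p : I -> {poly F}) (n : nat) (g : 'M[F]_n)
    (phi : 'cV[F]_n -> I -> {poly F}) : Prop :=
  [/\ (forall (a : F) (u v : 'cV[F]_n) i,
          phi (a *: u + v) i = a *: phi u i + phi v i),
      (forall u v, (forall i, phi u i = phi v i) -> u = v),
      (forall v i, size (phi v i) < size (p i))%N,
      (forall w : I -> {poly F}, (forall i, size (w i) < size (p i))%N ->
          exists v, forall i, phi v i = w i)
    & (forall v i, phi (g *m v) i = ('X * phi v i) %% p i)].

(* [has_type g lam] unfolds to [has_eldiv g (eldiv lam)]. *)
Definition has_eldiv (n : nat) (g : 'M[F]_n) (ps : seq {poly F}) : Prop :=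
  exists phi, module_iso (fun i : 'I_(size ps) => nth 0 ps i) g phi.

Lemma module_iso_reindex (I J : Type) (f : J -> I) (p : I -> {poly F})
    (p' : J -> {poly F}) n (g : 'M[F]_n) phi :
  bijective f -> (forall j, p' j = p (f j)) -> module_iso p g phi ->
  module_iso p' g (fun v j => phi v (f j)).
Proof.
case=> h fK hK pE [lin inj bnd sur com]; split.
- by move=> *; apply: lin.
- by move=> u v e; apply: inj => i; rewrite -(hK i).
- by move=> v i; rewrite pE.
- move=> w wb; have [|v vE] := sur (fun i => w (h i)).
    by move=> i; rewrite -{2}(hK i) -pE.
  by exists v => i; rewrite vE fK.
- by move=> v i; rewrite pE.
Qed.

Lemma has_eldiv_perm n (g : 'M[F]_n) ps ps' :
  perm_eq ps' ps -> has_eldiv g ps -> has_eldiv g ps'.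
Proof.
move=> pe [phi iso]; have sz := perm_size pe.
have pe' : perm_eq ps' (tcast (esym sz) (in_tuple ps)) by rewrite val_tcast.
have [s sE] := tuple_permP pe'.
have bs : bijective (fun j : 'I_(size ps') => cast_ord sz (s j)).
  exists (fun i => s^-1%g (cast_ord (esym sz) i)) => i.
    by rewrite cast_ordK permK.
  by rewrite permKV cast_ordKV.
eexists; apply: (module_iso_reindex bs _ iso) => j /=.
rewrite {1}sE (nth_map j) ?size_enum_ord // nth_ord_enum.
by rewrite tcastE (tnth_nth 0) /= ?esymK.
Qed.

(** Leads back from a finite index type to a list of elementary divisors, whose order is immaterial
    by [has_eldiv_perm]. *)
Lemma has_eldiv_image (I : finType) (p : I -> {poly F}) n (g : 'M[F]_n) phi :
  module_iso p g phi -> has_eldiv g [seq p i | i <- enum I].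
Proof.
have sz : size [seq p i | i <- enum I] = #|I| by rewrite size_map cardE.
move=> iso; eexists.
apply: (module_iso_reindex (f := fun j => enum_val (cast_ord sz j)) _ _ iso).
  exists (fun i => cast_ord (esym sz) (enum_rank i)) => i.
    by rewrite enum_valK cast_ordK.
  by rewrite cast_ordKV enum_rankK.
move=> j /=; have ji : (j < #|I|)%N by rewrite -sz.
rewrite (nth_map (enum_val (cast_ord sz j))) -?cardE //.
by congr p; rewrite [RHS](enum_val_nth (enum_val (cast_ord sz j))).
Qed.

Lemma module_iso_conj I (p : I -> {poly F}) n (g P : 'M[F]_n) phi :
  P \in unitmx -> module_iso p g phi ->
  module_iso p (P *m g *m invmx P) (fun v => phi (invmx P *m v)).
Proof.
move=> uP [lin inj bnd sur com]; split=> //.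
- by move=> a u v i; rewrite mulmxDr -scalemxAr lin.
- by move=> u v /inj e; rewrite -[u](mulKVmx uP) e mulKVmx.
- move=> w /sur[v vE]; exists (P *m v) => i.
  by rewrite mulKmx.
- by move=> v i; rewrite !mulmxA mulVmx // mul1mx -mulmxA com.
Qed.

Section Basic.
Variables (I : Type) (p : I -> {poly F}) (n : nat) (g : 'M[F]_n).
Variable phi : 'cV[F]_n -> I -> {poly F}.
Hypothesis iso : module_iso p g phi.

Lemma module_isoZD a u v i : phi (a *: u + v) i = a *: phi u i + phi v i.
Proof. by case: iso. Qed.

Lemma module_isoD u v i : phi (u + v) i = phi u i + phi v i.
Proof. by rewrite -[u]scale1r module_isoZD !scale1r. Qed.

Lemma module_iso0 i : phi 0 i = 0.
Proof. by apply: (addIr (phi 0 i)); rewrite -module_isoD !add0r. Qed.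

Lemma module_isoZ a u i : phi (a *: u) i = a *: phi u i.
Proof. by rewrite -[a *: u]addr0 module_isoZD module_iso0 addr0. Qed.

Lemma module_isoB u v i : phi (u - v) i = phi u i - phi v i.
Proof. by rewrite -scaleN1r module_isoD module_isoZ scaleN1r. Qed.

Lemma module_iso_sum (J : finType) (a : J -> F) (u : J -> 'cV_n) i :
  phi (\sum_j a j *: u j) i = \sum_j a j *: phi (u j) i.
Proof.
elim/big_rec2: _ => [|j x y _ <-]; first exact: module_iso0.
exact: module_isoZD.
Qed.

Lemma module_iso_sub1 v i : phi ((g - 1%:M) *m v) i = (('X - 1) * phi v i) %% p i.
Proof.
case: iso => lin inj bnd sur com.
rewrite mulmxBl mul1mx module_isoB com mulrBl mul1r modpD modpN.
by rewrite [phi v i %% _]modp_small.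
Qed.

End Basic.

(** [P] is the matrix of the inverse of [psi] composed with [phi], built on basis columns. The sizes
    may differ a priori; their equality is deduced in [module_iso_dim]. *)
Lemma module_iso_intertwine I (p : I -> {poly F}) m n (g : 'M[F]_m) (h : 'M[F]_n) phi psi :
  module_iso p g phi -> module_iso p h psi ->
  exists P : 'M[F]_(n, m), h *m P = P *m g /\ forall v i, psi (P *m v) i = phi v i.
Proof.
move=> isog isoh.
have ex (j : 'I_m) : exists u : 'cV_n, forall i, psi u i = phi (delta_mx j 0) i.
  case: isoh => _ _ _ + _; apply; by case: isog.
have [f fE] := choice ex.
pose P := \matrix_(i < n, j < m) f j i 0.
have PE v i : psi (P *m v) i = phi v i.
  have -> : P *m v = \sum_j v j 0 *: f j.
    apply/colP => k; rewrite !mxE summxE; apply: eq_bigr => j _.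
    by rewrite !mxE mulrC.
  have {2}-> : v = \sum_j v j 0 *: delta_mx j 0.
    by rewrite {1}[v]matrix_sum_delta; apply: eq_bigr => j _; rewrite big_ord1.
  by rewrite (module_iso_sum isoh) (module_iso_sum isog); apply: eq_bigr => j _; rewrite fE.
exists P; split=> //.
apply/matrixP => a b.
suff e : h *m P *m delta_mx b 0 = P *m g *m delta_mx b 0 :> 'cV_n.
  by move/colP/(_ a): e; rewrite -!colE !mxE.
case: (isoh) => _ inj _ _ com; apply: inj => i.
rewrite -!mulmxA com !PE.
by case: isog => _ _ _ _ ->.
Qed.

Lemma module_iso_retract I (p : I -> {poly F}) m n (g : 'M[F]_m) (h : 'M[F]_n) phi psi :
  module_iso p g phi -> module_iso p h psi ->
  exists P Q, h *m P = P *m g /\ Q *m P = 1%:M.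
Proof.
move=> isog isoh; have [P [hP PE]] := module_iso_intertwine isog isoh.
have [Q [_ QE]] := module_iso_intertwine isoh isog.
exists P, Q; split=> //; apply/matrixP => a b.
suff /colP/(_ a) : Q *m P *m delta_mx b 0 = delta_mx b 0 :> 'cV_m.
  by rewrite -colE !mxE eqxx andbT.
by case: (isog) => _ inj _ _ _; apply: inj => i; rewrite -mulmxA QE PE.
Qed.

Lemma module_iso_similar I (p : I -> {poly F}) n (g h : 'M[F]_n) phi psi :
  module_iso p g phi -> module_iso p h psi ->
  exists2 P : 'M[F]_n, P \in unitmx & h *m P = P *m g.
Proof.
move=> isog isoh; have [P [Q [hP QP]]] := module_iso_retract isog isoh.
by exists P => //; case/mulmx1_unit: QP.
Qed.

(** The identity of size [k] factors through a space of dimension [l], so [k <= l]; exchanging the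
    roles gives equality. *)
Lemma module_iso_dim I (p : I -> {poly F}) m n (g : 'M[F]_m) (h : 'M[F]_n) phi psi :
  module_iso p g phi -> module_iso p h psi -> m = n.
Proof.
have le k l (a : 'M[F]_k) (b : 'M[F]_l) al be :
    module_iso p a al -> module_iso p b be -> (k <= l)%N.
  move=> isoa isob; have [P [Q [_ QP]]] := module_iso_retract isoa isob.
  by rewrite -(mxrank1 F k) -QP; apply: leq_trans (mxrankM_maxl _ _) (rank_leq_col _).
move=> isog isoh; apply/eqP.
by rewrite eqn_leq (le _ _ _ _ _ _ isog isoh) (le _ _ _ _ _ _ isoh isog).
Qed.

End ModuleIso.

(** * Stabilization g |-> diag(g, 1) *)

Section Stabilization.
Variable F : finFieldType.
Implicit Types (p q : {poly F}).

Definition stab n (g : 'M[F]_n) : 'M[F]_(n + 1) := block_mx g 0 0 1%:M.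

Lemma stab_col n (g : 'M[F]_n) (u : 'cV[F]_n) (c : 'cV[F]_1) :
  stab g *m col_mx u c = col_mx (g *m u) c.
Proof. by rewrite mul_block_col !mul0mx mul1mx addr0 add0r. Qed.

Lemma stab_unit n (g : 'M[F]_n) : (stab g \in unitmx) = (g \in unitmx).
Proof. by rewrite !unitmxE det_ublock det1 mulr1. Qed.

Lemma stabM n (g h : 'M[F]_n) : stab (g *m h) = stab g *m stab h.
Proof. by rewrite mulmx_block !mulmx0 !mul0mx mulmx1 !addr0 add0r. Qed.

Lemma stab_inj n : injective (@stab n).
Proof. by move=> g h /eq_block_mx[]. Qed.

Lemma stab_inv n (g : 'M[F]_n) : g \in unitmx -> invmx (stab g) = stab (invmx g).
Proof.
move=> gu; have gu' : stab g \in unitmx by rewrite stab_unit.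
have e : stab g *m stab (invmx g) = 1%:M by rewrite -stabM mulmxV // /stab -scalar_mx_block.
by rewrite -[LHS]mulmx1 -e mulKmx.
Qed.

Lemma size_Xsub1 : size ('X - 1 : {poly F}) = 2%N.
Proof. by rewrite size_XsubC. Qed.

Lemma Xsub1_neq0 : 'X - 1 != 0 :> {poly F}.
Proof. by rewrite -size_poly_gt0 size_Xsub1. Qed.

Lemma modXsub1_const (c : {poly F}) : (size c < 2)%N -> ('X * c) %% ('X - 1) = c.
Proof.
move=> sc; rewrite -[X in X * _](subrK 1) mulrDl mul1r modpD modp_mulr ?add0r.
by rewrite modp_small ?size_Xsub1.
Qed.

Lemma size_lt2_scale (q r : {poly F}) : (size q < 2)%N -> (size r < 2)%N -> q`_0 *: r = r`_0 *: q.
Proof.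
move=> sq sr; rewrite (size1_polyC (_ : size q <= 1)%N) // (size1_polyC (_ : size r <= 1)%N) //.
by rewrite !coefC !eqxx -!mul_polyC mulrC.
Qed.

(** The new basis vector is fixed by [stab g], hence spans a summand F[t]/(t - 1), indexed by
    [None]. *)
Lemma module_iso_stab I (p : I -> {poly F}) n (g : 'M[F]_n) phi :
  module_iso p g phi ->
  module_iso (oapp p ('X - 1)) (stab g)
    (fun v i => if i is Some j then phi (usubmx v) j else (dsubmx v 0 0)%:P).
Proof.
case=> lin inj bnd sur com; split.
- move=> a u v [i|] //=; first by rewrite linearP lin.
  by rewrite linearP !mxE polyCD polyCM mul_polyC.
- move=> u v e; rewrite -[u]vsubmxK -[v]vsubmxK; congr col_mx.
    by apply: inj => i; apply: (e (Some i)).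
  by apply/colP=> i; rewrite ord1; apply: polyC_inj (e None).
- by move=> v [i|] //=; rewrite size_Xsub1 ltnS size_polyC_leq1.
- move=> w wb; have [u uE] := sur (fun i => w (Some i)) (fun i => wb (Some i)).
  exists (col_mx u (const_mx (w None)`_0)) => -[i|]; first by rewrite col_mxKu uE.
  rewrite col_mxKd mxE -size1_polyC //.
  by have := wb None; rewrite /= size_Xsub1.
- move=> v i; rewrite -[v]vsubmxK stab_col; case: i => [i|]; rewrite ?col_mxKu ?col_mxKd //=.
  by rewrite modXsub1_const // ltnS size_polyC_leq1.
Qed.

(** The only property of elementary divisors needed to decide when a vector fixed by t is a multiple
    of t - 1. *)
Definition primary_Xsub1 p := ('X - 1) %| p -> exists k, p = ('X - 1) ^+ k.+1.

(** If t - 1 does not divide p, it acts injectively and w = 0. If p is a power of t - 1 with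
    exponent at least 2, its kernel consists of multiples of the next lower power, which is still
    divisible by t - 1. *)
Lemma fixed_in_image (p w : {poly F}) : primary_Xsub1 p -> p != 'X - 1 -> (size w < size p)%N ->
  (('X - 1) * w) %% p = 0 ->
  exists2 u : {poly F}, (size u < size p)%N & w = (('X - 1) * u) %% p.
Proof.
move=> prim pX sw /modp_eq0P dv.
have p0 : p != 0 by rewrite -size_poly_gt0; apply: leq_ltn_trans sw.
have [/prim[[|k] pE]|nd] := boolP (('X - 1) %| p).
- by rewrite pE eqxx in pX.
- have : ('X - 1) ^+ k.+1 %| w by rewrite -(dvdp_mul2l _ _ Xsub1_neq0) -exprS -pE.
  case/dvdpP => c wE; exists (c * ('X - 1) ^+ k); last first.
    by rewrite mulrCA -exprS -wE modp_small.
  have [->|c0] := eqVneq c 0; first by rewrite mul0r size_poly0 size_poly_gt0.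
  apply: leq_ltn_trans sw; rewrite wE exprSr mulrA.
  rewrite [leqRHS]size_Mmonic ?monicXsubC ?mulf_neq0 ?expf_neq0 ?Xsub1_neq0 //.
  by rewrite size_Xsub1 addn2.
- exists 0; first by rewrite size_poly0 size_poly_gt0.
  have : p %| w.
    rewrite -(@Gauss_dvdpr _ _ ('X - 1)) // coprimep_sym irreducible_poly_coprime //.
    exact: irredp_XsubC.
  rewrite mulr0 mod0p => pw; apply/eqP; apply: contraTT pw => w0; by rewrite gtNdvdp.
Qed.

(* Exchange: a fixed vector spanning a complement is not in the image of
   [g - 1], so some component of it generates a summand F[t]/(t - 1). *)
Lemma stab_module_iso_component I (p : I -> {poly F}) n (g : 'M[F]_n) phi :
  (forall i, primary_Xsub1 (p i)) -> module_iso p (stab g) phi ->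
  exists2 i, p i = 'X - 1 & phi (col_mx 0 1%:M) i != 0.
Proof.
move=> prim iso; apply: contrapT => /forall2NP no.
set w := col_mx _ _ in no.
have fixw : stab g *m w = w by rewrite stab_col mulmx0.
have ex i : exists u : {poly F}, (size u < size (p i))%N /\ phi w i = (('X - 1) * u) %% p i.
  have sw : (size (phi w i) < size (p i))%N by case: iso.
  have [wi0|wi0] := eqVneq (phi w i) 0.
    by exists 0; rewrite size_poly0 (leq_ltn_trans _ sw) // wi0 mulr0 mod0p.
  have [||u us ue] := fixed_in_image (prim i) _ sw; last by exists u.
    by apply/eqP => e; case: (no i) => //; apply.
  by rewrite -(module_iso_sub1 iso) mulmxBl mul1mx fixw subrr (module_iso0 iso).
have [u uE] := choice ex.
have [v vE] : exists v, forall i, phi v i = u i.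
  by case: iso => _ _ _ + _; apply=> i; case: (uE i).
have : w = (stab g - 1%:M) *m v.
  case: (iso) => _ inj _ _ _; apply: inj => i.
  by rewrite (module_iso_sub1 iso) vE; case: (uE i).
(* The last coordinate vanishes on the image of [stab g - 1], whereas that of [w] is 1. *)
rewrite mulmxBl mul1mx -[v]vsubmxK stab_col opp_col_mx add_col_mx => /eq_col_mx[_].
by rewrite subrr => /eqP; rewrite oner_eq0.
Qed.

(* Splits the fixed vector w off: as w has a nonzero component at [None],
   subtracting a multiple of it clears that component. *)
Lemma stab_module_iso_cancel J (p : option J -> {poly F}) n (g : 'M[F]_n) phi :
  p None = 'X - 1 -> phi (col_mx 0 1%:M) None != 0 -> module_iso p (stab g) phi ->
  exists psi, module_iso (fun j => p (Some j)) g psi.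
Proof.
move=> pN; set w := col_mx _ _ => wN iso.
have [_ inj bnd sur com] := iso.
have sN v : (size (phi v None) < 2)%N by rewrite -size_Xsub1 -pN.
pose a := (phi w None)`_0.
have a0 : a != 0.
  by move: wN; rewrite (size1_polyC (sN w : _ <= 1)%N) polyC_eq0.
pose c v := (phi v None)`_0 / a.
have cE v : phi v None = c v *: phi w None.
  by rewrite /c mulrC -scalerA (size_lt2_scale (sN v) (sN w)) scalerA mulVf ?scale1r.
have colE u b : col_mx u b%:M = col_mx u 0 + b *: w.
  by rewrite /w scale_col_mx scaler0 add_col_mx addr0 add0r scalemx1.
pose e (u : 'cV[F]_n) : 'cV[F]_(n + 1) := col_mx u 0.
have eZD b u v : e (b *: u + v) = b *: e u + e v.
  by rewrite /e scale_col_mx add_col_mx scaler0 addr0.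
have cZD b u v : c (b *: u + v) = b * c u + c v.
  by rewrite /c (module_isoZD iso) coefD coefZ mulrDl mulrA.
have fixw i : phi w i = ('X * phi w i) %% p i by rewrite -com stab_col mulmx0.
(* These are the coordinates of [e u - c (e u) *: w], the representative of [e u] modulo [w] whose
   [None] component is zero. *)
exists (fun u j => phi (e u) (Some j) - c (e u) *: phi w (Some j)); split.
- move=> b u v j; rewrite eZD cZD (module_isoZD iso) scalerDl -scalerA.
  by rewrite scalerBr opprD addrACA.
- move=> u v h; suff : e u - c (e u) *: w = e v - c (e v) *: w.
    rewrite /e /w !scale_col_mx !opp_col_mx !add_col_mx !scaler0 !subr0.
    by case/eq_col_mx.
  apply: inj => -[j|]; rewrite !(module_isoB iso) !(module_isoZ iso); first exact: h.
  by rewrite -!cE !subrr.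
- move=> v j; rewrite -(module_isoZ iso) -(module_isoB iso); exact: bnd.
(* Extend [y] by 0 at [None] and lift it to [v]. The upper block of [v] is the required vector: it
   differs from [v] by [b *: w], and [c] takes the value [- b] on it. *)
- move=> y yb; have [|v vE] := sur (fun i => if i is Some j then y j else 0).
    by case=> [j|]; [exact: yb | rewrite pN size_Xsub1 size_poly0].
  pose b := dsubmx v 0 0.
  have vE' : v = e (usubmx v) + b *: w.
    by rewrite -colE -[LHS]vsubmxK; congr col_mx; apply/colP=> i; rewrite ord1 [RHS]mxE mulr1n.
  exists (usubmx v) => j.
  have eE : e (usubmx v) = (- b) *: w + v by rewrite {2}vE' addrCA scaleNr addNr addr0.
  have cv : c v = 0 by rewrite /c vE coef0 mul0r.
  have cw : c w = 1 by rewrite /c divff.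
  by rewrite eE cZD cv cw addr0 mulr1 (module_isoZD iso) vE addrAC subrr add0r.
- move=> v j.
  have eg : e (g *m v) = stab g *m e v by rewrite stab_col.
  rewrite eg mulrBr -scalerAr modpD modpN modpZl -fixw -com; congr (_ - _ *: _).
  by rewrite /c com pN modXsub1_const.
Qed.

End Stabilization.

(** * The rank of g - 1 *)

Section Rank.
Variable F : finFieldType.
Implicit Types (p q : {poly F}).

(* The rank of multiplication by t - 1 on F[t]/(p). *)
Definition rank_Xsub1 p : nat := ((size p).-1 - (('X - 1)%R %| p)%R)%N.

(** The kernel of t - 1 on F[t]/(p) is zero, or consists of the multiples of p/(t - 1), whose size
    is one more than the bound. So the polynomials within the bound form a complement of the
    kernel. *)
Lemma Xsub1_mod_inj p (u : {poly F}) : p != 0 -> (size u <= rank_Xsub1 p)%N ->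
  (('X - 1) * u) %% p = 0 -> u = 0.
Proof.
move=> p0 + /modp_eq0P; rewrite /rank_Xsub1 -size_poly_gt0 in p0 *.
have [/dvdpP[q pE]|nd] := boolP (('X - 1) %| p) => su dv.
- have q0 : q != 0 by apply: contraTneq p0 => q0; rewrite pE q0 mul0r size_poly0.
  have qu : q %| u by rewrite -(dvdp_mul2l _ _ (Xsub1_neq0 F)) mulrC -pE.
  apply/eqP; apply: contraTT qu => u0; rewrite gtNdvdp //.
  apply: leq_ltn_trans su _.
  rewrite pE size_Mmonic ?monicXsubC // size_Xsub1 addn2 /= subn1 prednK ?size_poly_gt0 //.
- have pu : p %| u.
    rewrite -(@Gauss_dvdpr _ _ ('X - 1)) // coprimep_sym irreducible_poly_coprime //.
    exact: irredp_XsubC.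
  apply/eqP; apply: contraTT pu => u0; rewrite gtNdvdp //.
  by apply: leq_ltn_trans su _; rewrite subn0 prednK.
Qed.

(** Reducing w modulo p/(t - 1), or modulo p when t - 1 does not divide p, leaves (t - 1) w
    unchanged modulo p. *)
Lemma Xsub1_mod_surj p (w : {poly F}) : p != 0 ->
  exists2 u : {poly F}, (size u <= rank_Xsub1 p)%N &
    (('X - 1) * u) %% p = (('X - 1) * w) %% p.
Proof.
rewrite /rank_Xsub1 => p0.
have [/dvdpP[q pE]|nd] := boolP (('X - 1) %| p).
- have q0 : q != 0 by apply: contraNneq p0 => q0; rewrite pE q0 mul0r.
  exists (w %% q).
    rewrite pE size_Mmonic ?monicXsubC // size_Xsub1 addn2 /= subn1 -ltnS.
    by rewrite prednK ?size_poly_gt0 // ltn_modp.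
  by rewrite [in RHS](divp_eq w q) mulrDr modpD mulrCA [_ * q]mulrC -pE modp_mull add0r.
- exists (w %% p); last by rewrite modp_mul.
  by rewrite subn0 -ltnS prednK ?size_poly_gt0 // ltn_modp.
Qed.

(* Counts the image of [g - 1]: it is in bijection with the families of
   polynomials u_i of size at most [rank_Xsub1 (p i)], through (t - 1) u_i mod p_i. *)
Lemma module_iso_rank (I : finType) (p : I -> {poly F}) n (g : 'M[F]_n) phi :
  (forall i, p i != 0) -> module_iso p g phi ->
  \rank (g - 1%:M) = (\sum_i rank_Xsub1 (p i))%N.
Proof.
move=> p0 iso; have [_ inj bnd sur _] := iso.
pose d i := rank_Xsub1 (p i).
pose E := {ffun {i : I & 'I_(d i)} -> F}.
pose U (y : E) i := rVpoly (\row_k y (Tagged (fun i => 'I_(d i)) k) : 'rV_(d i)).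
have sU y i : (size (U y i) <= d i)%N by apply: size_poly.
have ex (y : E) : exists v, forall i, phi v i = (('X - 1) * U y i) %% p i.
  by apply: sur => i; rewrite ltn_modp.
have [f fE] := choice ex.
pose h y := (f y)^T.
have hinj : injective h.
  move=> y z /trmx_inj yz; apply/ffunP => -[i k].
  have UB : U y i - U z i = 0.
    apply: (Xsub1_mod_inj (p0 i)); last first.
      by rewrite mulrBr modpD modpN -!fE yz subrr.
    by apply: leq_trans (size_polyD _ _) _; rewrite size_polyN geq_max !sU.
  move/eqP: UB; rewrite subr_eq0 => /eqP /(can_inj (@rVpolyK _ _)) /rowP/(_ k).
  by rewrite !mxE.
(* [rowg] collects row vectors, so the image of [g - 1] on columns appears transposed. *)
have img : [set h y | y : E] = rowg (g - 1%:M)^T.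
  apply/setP => x; rewrite inE; apply/imsetP/idP.
  - case=> y _ ->{x}; have [|v vE] := sur (fun i => U y i %% p i).
      by move=> i; rewrite ltn_modp.
    have fyE : f y = (g - 1%:M) *m v.
      by apply: inj => i; rewrite (module_iso_sub1 iso) vE fE modp_mul.
    by rewrite /h fyE trmx_mul submxMl.
  - case/submxP => D xE.
    have ex2 i := Xsub1_mod_surj (phi D^T i) (p0 i).
    have ex3 i : exists u : {poly F}, (size u <= d i)%N /\
        (('X - 1) * u) %% p i = (('X - 1) * phi D^T i) %% p i.
      by case: (ex2 i) => u; exists u.
    have [u uE] := choice ex3.
    exists [ffun t => poly_rV (d := d (tag t)) (u (tag t)) 0 (tagged t)] => //.
    rewrite xE -[D]trmxK -trmx_mul; congr trmx; apply: inj => i.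
    rewrite (module_iso_sub1 iso) fE -(uE i).2; congr ((_ * _) %% _).
    rewrite -[LHS](poly_rV_K (uE i).1); congr rVpoly; apply/rowP => k.
    by rewrite !mxE ffunE !mxE.
(* Both sides become exponents of the cardinality of F: that of the row space and that of the
   coefficient families [E]. *)
have := card_rowg (g - 1%:M)^T; rewrite -img card_imset // card_ffun mxrank_tr.
rewrite card_tagged sumnE big_map big_enum /=.
have q1 : (1 < #|F|)%N by apply: finNzRing_gt1.
by move/(expnI q1) => <-; apply: eq_bigr => i _; rewrite card_ord.
Qed.

End Rank.

(** * Types and modified types *)

Section ModifiedType.
Variable F : finFieldType.
Implicit Types (p q f : {poly F}) (lam mu nu : mpart F).

Local Notation powers lam f := [seq f ^+ k | k <- lam f].

(** Polynomials outside the support contribute empty lists. Two types with different supports can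
    thus be compared over one common list. *)
Lemma eldiv_perm lam (s : seq {poly F}) : uniq s -> {subset finsupp lam <= s} ->
  perm_eq (eldiv lam) (flatten [seq powers lam f | f <- s]).
Proof.
move=> us sub.
have -> : flatten [seq powers lam f | f <- s]
        = flatten [seq powers lam f | f <- s & f \in finsupp lam].
  elim: s {us sub} => //= f s ->; case: finsuppP => //= _.
apply: perm_flatten; apply: perm_map.
apply: uniq_perm; rewrite ?filter_uniq ?fset_uniq // => f; rewrite mem_filter.
by case: (boolP (f \in finsupp lam)) => // /sub ->.
Qed.

Lemma eldiv_add1 lam lam' :
  (forall f, f != 'X - 1 -> lam' f = lam f) ->
  perm_eq (lam' ('X - 1)) (1%N :: lam ('X - 1)) ->
  perm_eq (eldiv lam') (('X - 1) :: eldiv lam).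
Proof.
move=> off at1.
pose s := rem ('X - 1) (undup (finsupp lam ++ finsupp lam')).
have us : uniq (('X - 1) :: s).
  by rewrite /= rem_uniq ?undup_uniq // mem_rem_uniqF ?undup_uniq.
have sub (k : mpart F) : k = lam \/ k = lam' -> {subset finsupp k <= ('X - 1) :: s}.
  move=> kE f fk; rewrite inE mem_rem_uniq ?undup_uniq // !inE mem_undup mem_cat.
  by case: eqP => //= _; case: kE fk => -> ->; rewrite ?orbT.
rewrite (permPl (eldiv_perm us (sub lam' (or_intror erefl)))).
have e := eldiv_perm us (sub lam (or_introl erefl)).
rewrite -(perm_cons ('X - 1)) in e; rewrite (permPr e) /=.
have -> : [seq powers lam' f | f <- s] = [seq powers lam f | f <- s].
  apply/eq_in_map => f; rewrite mem_rem_uniq ?undup_uniq // => /andP[fX _].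
  by rewrite off.
rewrite -cat_cons perm_cat2r -[X in X :: _]expr1.
exact: (perm_map (fun k => ('X - 1) ^+ k) at1).
Qed.

Lemma mem_eldiv lam q : is_mpart lam -> q \in eldiv lam ->
  exists f k, [/\ q = f ^+ k.+1, k.+1 \in lam f & inPhi f].
Proof.
move=> lamP /flatten_mapP[f fl /mapP[k kl ->]].
have [/andP[_ /allP/(_ k kl) k0] fP] := lamP f.
exists f, k.-1; rewrite prednK //; split=> //.
by apply: fP; rewrite -mem_finsupp.
Qed.

Lemma inPhi_Xsub1 : inPhi ('X - 1 : {poly F}).
Proof.
split; first exact: monicXsubC.
  exact: irredp_XsubC.
by rewrite -subr_eq0 addrAC subrr add0r oppr_eq0 oner_eq0.
Qed.

Lemma inPhi_dvd_exp f k : inPhi f -> ('X - 1) %| f ^+ k -> f = 'X - 1.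
Proof.
case=> fm fi _ dv; apply/eqP; rewrite -eqp_monic ?monicXsubC // eqp_sym.
apply: fi; first by rewrite size_Xsub1.
apply: contraTT dv => nd.
have cop : coprimep ('X - 1) f.
  by rewrite irreducible_poly_coprime //; apply: irredp_XsubC.
rewrite -irreducible_poly_coprime; last exact: irredp_XsubC.
exact: coprimep_expr.
Qed.

Lemma eldiv_neq0 lam q : is_mpart lam -> q \in eldiv lam -> q != 0.
Proof.
move=> lamP /(mem_eldiv lamP)[f [k [-> _ [fm _ _]]]].
by rewrite expf_neq0 // monic_neq0.
Qed.

Lemma eldiv_primary lam q : is_mpart lam -> q \in eldiv lam -> primary_Xsub1 q.
Proof.
move=> lamP /(mem_eldiv lamP)[f [k [-> _ fP]]] /(inPhi_dvd_exp fP) ->.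
by exists k.
Qed.

Lemma Xsub1_mem_eldiv lam : is_mpart lam -> 'X - 1 \in eldiv lam ->
  1%N \in lam ('X - 1).
Proof.
move=> lamP /(mem_eldiv lamP)[f [k [E kl fP]]].
have fE : f = 'X - 1 by apply: (inPhi_dvd_exp (k := k.+1) fP); rewrite -E.
(* Comparing degrees in t - 1 = (t - 1)^(k+1) forces k = 0. *)
have := size_exp f k.+1; rewrite -E fE size_Xsub1 mul1n => -[k0].
by rewrite -fE k0.
Qed.

Lemma is_mpart_with lam s : is_mpart lam -> is_partition s ->
  is_mpart [fsfun lam with 'X - 1 |-> s].
Proof.
move=> lamP sP f; rewrite fsfun_withE; case: eqP => [->|_]; last exact: lamP.
by split=> // _; apply: inPhi_Xsub1.
Qed.

Lemma is_partition_rcons1 s : is_partition s -> is_partition (rcons s 1%N).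
Proof.
case/andP=> so po; rewrite /is_partition all_rcons po /= andbT.
case: s so po => // x s so /allP po; rewrite /= rcons_path [path _ _ _]so.
exact: po (mem_last x s).
Qed.

Lemma is_partition_rem1 s : is_partition s -> is_partition (rem 1%N s).
Proof.
case/andP=> so /allP po; apply/andP; split.
  by apply: subseq_sorted so; [move=> x y z /[swap]; apply: leq_trans | apply: rem_subseq].
by apply/allP => x /mem_rem/po.
Qed.

(** The operation of [has_modtype] at t - 1. Parts equal to 1 leave no trace in it, which makes
    modified types stable. *)
Definition pred_parts (s : seq nat) := [seq k.-1 | k <- s & (1 < k)%N].

Lemma pred_parts_rcons1 s : pred_parts (rcons s 1%N) = pred_parts s.
Proof. by rewrite /pred_parts filter_rcons. Qed.

Lemma pred_parts_rem1 s : pred_parts (rem 1%N s) = pred_parts s.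
Proof.
rewrite /pred_parts; congr map; elim: s => //= x s IH.
by case: eqP => [->|_] //=; rewrite IH.
Qed.

Lemma enum_option (I : finType) : enum {: option I} = None :: [seq Some i | i <- enum I].
Proof. by rewrite !enumT [in LHS]unlock. Qed.

Lemma has_type_stab lam n (g : 'M[F]_n) : is_mpart lam -> has_type g lam ->
  let lam' := [fsfun lam with 'X - 1 |-> rcons (lam ('X - 1)) 1%N] in
  is_mpart lam' /\ has_type (stab g) lam'.
Proof.
move=> lamP [phi iso] lam'; split.
  by apply: is_mpart_with => //; apply: is_partition_rcons1; case: (lamP ('X - 1)).
have pe : perm_eq (eldiv lam') (('X - 1) :: eldiv lam).
  apply: eldiv_add1 => [f fX|]; first by rewrite fsfun_withE (negPf fX).
  by rewrite fsfun_with perm_rcons.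
apply: has_eldiv_perm (has_eldiv_image (module_iso_stab iso)).
rewrite (permPl pe) enum_option /= perm_cons -map_comp.
rewrite -[X in perm_eq X](mkseq_nth 0 (eldiv lam)) /mkseq -val_enum_ord -map_comp.
exact: perm_refl.
Qed.

(** Singles out the summand [i0] as [None], the form in which [stab_module_iso_cancel] removes
    it. *)
Lemma lift_opt_bij m (i0 : 'I_m.+1) : bijective (oapp (lift i0) i0).
Proof.
exists (unlift i0) => [[j|]|i] /=; first by rewrite liftK.
  by rewrite unlift_none.
by case: unliftP => [j ->|->].
Qed.

(** The vector fixed by [stab g] has a nonzero component in some summand F[t]/(t - 1); cancelling
    the two against each other leaves the remaining summands for [g]. *)
Lemma has_type_unstab lam n (g : 'M[F]_n) : is_mpart lam -> has_type (stab g) lam ->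
  let lam' := [fsfun lam with 'X - 1 |-> rem 1%N (lam ('X - 1))] in
  is_mpart lam' /\ has_type g lam'.
Proof.
move=> lamP [phi iso] lam'; split.
  by apply: is_mpart_with => //; apply: is_partition_rem1; case: (lamP ('X - 1)).
have [|i iX phi_i] := stab_module_iso_component _ iso.
  by move=> i; apply: (eldiv_primary lamP); apply: mem_nth.
have X_in : 'X - 1 \in eldiv lam by rewrite -iX mem_nth.
have pe : perm_eq (eldiv lam) (('X - 1) :: eldiv lam').
  apply: eldiv_add1 => [f fX|]; first by rewrite fsfun_withE (negPf fX).
  by rewrite fsfun_with; apply: perm_to_rem; apply: Xsub1_mem_eldiv.
(* Only the two lists matter from here on. Generalizing them lets the first be written as a cons, so
   that its index type is an ordinal ['I_m.+1] to which [lift] applies. *)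
rewrite -[has_type _ _]/(has_eldiv g (eldiv lam')).
move: (eldiv lam) (eldiv lam') X_in pe phi iso i iX phi_i => ps ps' _ pe.
case: ps pe => [|q ps] pe phi iso i iX phi_i; first by case: i iX phi_i.
have [psi iso'] := stab_module_iso_cancel (p := fun j => nth 0 (q :: ps) (oapp (lift i) i j))
  iX phi_i (module_iso_reindex (lift_opt_bij i) (fun=> erefl) iso).
apply: has_eldiv_perm (has_eldiv_image iso').
rewrite perm_sym.
(* The removed index together with the lifted ones exhausts all indices, so the lists agree up to
   order once t - 1 is removed from both. *)
have pi : perm_eq (i :: [seq lift i j | j <- enum 'I_(size ps)]) (enum 'I_(size (q :: ps))).
  apply: uniq_perm; rewrite ?enum_uniq //=.
    rewrite map_inj_uniq ?enum_uniq ?andbT; last exact: lift_inj.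
    by apply/mapP => -[j _ /eqP]; rewrite (negPf (neq_lift i j)).
  move=> j; rewrite mem_enum inE; case: (unliftP i j) => [k ->|->]; last by rewrite eqxx.
  by rewrite map_f ?orbT ?mem_enum.
have := perm_map (fun j : 'I__ => nth 0 (q :: ps) j) pi.
rewrite /= -map_comp [X in perm_eq _ X](map_comp (nth 0 (q :: ps)) val) val_enum_ord.
rewrite -/(mkseq _ (size (q :: ps))) mkseq_nth => e.
by have := perm_trans e pe; rewrite iX perm_cons.
Qed.

Lemma has_modtype_stab n (g : 'M[F]_n) mu : has_modtype (stab g) mu <-> has_modtype g mu.
Proof.
split=> -[lam [lamP ty off at1]].
- have [lamP' ty'] := has_type_unstab lamP ty; eexists; split; [exact: lamP' | exact: ty' | |].
    by move=> f fX; rewrite fsfun_withE (negPf fX) off.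
  by rewrite fsfun_with at1 -[RHS]/(pred_parts _) pred_parts_rem1.
- have [lamP' ty'] := has_type_stab lamP ty; eexists; split; [exact: lamP' | exact: ty' | |].
    by move=> f fX; rewrite fsfun_withE (negPf fX) off.
  by rewrite fsfun_with at1 -[RHS]/(pred_parts _) pred_parts_rcons1.
Qed.

Lemma has_modtype_conj n (g P : 'M[F]_n) mu :
  P \in unitmx -> has_modtype g mu -> has_modtype (P *m g *m invmx P) mu.
Proof.
move=> uP [lam [lamP [phi ty] off at1]]; exists lam; split=> //.
by exists (fun v => phi (invmx P *m v)); apply: module_iso_conj.
Qed.

(** For f other than t - 1, multiplication by t - 1 is invertible modulo f^k and the rank is the
    full degree; for f = t - 1 its kernel is a line. *)
Lemma rank_Xsub1_exp f k : inPhi f -> (0 < k)%N ->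
  rank_Xsub1 (f ^+ k) = if f == 'X - 1 then k.-1 else (pdeg f * k)%N.
Proof.
move=> fP k0; rewrite /rank_Xsub1 /pdeg size_exp; case: eqP => [->|nX].
  by rewrite size_Xsub1 mul1n -[k in X in _ %| X]prednK // exprS dvdp_mulr // subn1.
case: (boolP (_ %| _)) => [/(inPhi_dvd_exp fP)//|_]; by rewrite subn0.
Qed.

Lemma has_modtype_rank n (g : 'M[F]_n) mu :
  has_modtype g mu -> \rank (g - 1%:M) = mnorm mu.
Proof.
case=> lam [lamP [phi iso] off at1].
rewrite (module_iso_rank _ iso) => [|i]; last first.
  by apply: (eldiv_neq0 lamP); apply: mem_nth.
rewrite -(big_mkord xpredT (fun i => rank_Xsub1 (nth 0 (eldiv lam) i))).
rewrite -(big_nth 0 xpredT (@rank_Xsub1 F)) /eldiv big_flatten /= big_map.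
(* The inclusion can be strict: when all parts of [lam] at t - 1 equal 1, t - 1 drops out of the
   support of [mu]. *)
have sub f : f \in finsupp mu -> f \in finsupp lam.
  rewrite !mem_finsupp; case: (eqVneq f ('X - 1)) => [->|fX]; last by rewrite off.
  by rewrite at1; case: (lam _).
have {}sub : (finsupp mu `<=` finsupp lam)%fset by apply/fsubsetP.
rewrite /mnorm (big_fset_incl _ sub) => [|f _]; last first.
  by rewrite memNfinsupp => /eqP -> /=; rewrite muln0.
apply: eq_big_seq => f; rewrite mem_finsupp big_map => f_lam.
have [/andP[_ /allP lam_gt0] /(_ f_lam) fP] := lamP f.
transitivity (\sum_(k <- lam f) if (f == 'X - 1)%R then k.-1 else pdeg f * k)%N.
  by apply: eq_big_seq => k /lam_gt0; apply: rank_Xsub1_exp.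
have [->|fX] := eqVneq f ('X - 1); last by rewrite off // sumnE big_distrr.
rewrite at1 sumnE big_map big_filter /pdeg size_Xsub1 mul1n [RHS]big_mkcond.
by apply: eq_bigr => -[|[]].
Qed.

End ModifiedType.

(** * Structure constants *)

Section Coefficient.
Variable F : finFieldType.
Implicit Types (lam mu nu : mpart F).

(** A factorization z = x y is recorded by its left factor alone. *)
Definition factorizations lam mu n (z : 'M[F]_n) : {set 'M[F]_n} :=
  [set x : 'M[F]_n | [&& x \in unitmx, `[< has_modtype x lam >]
                       & `[< has_modtype (invmx x *m z) mu >]]].

(** Each term of the convolution is a product of two indicators; the resulting count gives
    integrality and nonnegativity. *)
Lemma coeff_atE lam mu n (z : 'M[F]_n) : z \in unitmx ->
  coeff_at lam mu z = (#|factorizations lam mu z|)%:Z.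
Proof.
move=> zu; rewrite /coeff_at /galg_mul ffunE -sum1_card -[RHS]natz natr_sum.
rewrite big_mkcond [RHS]big_mkcond /=.
apply: eq_bigr => x _; rewrite !ffunE inE; case xu: (x \in unitmx) => //=.
rewrite unitmx_mul unitmx_inv xu zu /=.
by case: `[< _ >] => /=; rewrite ?mul0r // mul1r; case: `[< _ >].
Qed.

(** Conjugation by P injects the factorizations of z into those of y; conjugation by its inverse
    gives the opposite inequality. *)
Lemma coeff_at_conj lam mu n (y z P : 'M[F]_n) :
  P \in unitmx -> y *m P = P *m z -> y \in unitmx -> z \in unitmx ->
  coeff_at lam mu y = coeff_at lam mu z.
Proof.
move=> uP.
have le (a b Q : 'M[F]_n) : Q \in unitmx -> a *m Q = Q *m b ->
    (#|factorizations lam mu b| <= #|factorizations lam mu a|)%N.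
  move=> uQ aQ; pose h x := Q *m x *m invmx Q.
  have hinj : injective h by move=> u v /(can_inj (mulmxKV uQ))/(can_inj (mulKmx uQ)).
  rewrite -(card_imset _ hinj); apply: subset_leq_card; apply/subsetP => _ /imsetP[x + ->].
  rewrite !inE => /and3P[xu /asboolP xl /asboolP xm]; apply/and3P; split.
  - by rewrite !unitmx_mul uQ xu unitmx_inv.
  - by apply/asboolP; apply: has_modtype_conj.
  - apply/asboolP; suff -> : invmx (h x) *m a = Q *m (invmx x *m b) *m invmx Q.
      exact: has_modtype_conj.
    have -> : a = Q *m b *m invmx Q by rewrite -aQ mulmxK.
    have hu : h x \in unitmx by rewrite !unitmx_mul uQ xu unitmx_inv.
    rewrite -[RHS](mulKmx hu) /h; congr (_ *m _); rewrite !mulmxA.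
    by rewrite mulmxKV // mulmxK.
move=> yP yu zu; rewrite !coeff_atE //; congr Posz; apply/eqP; rewrite eqn_leq.
rewrite (le _ _ _ uP yP) andbT.
apply: (le _ _ (invmx P)); first by rewrite unitmx_inv.
by rewrite -[LHS](mulKmx uP) [P *m (_ *m _)]mulmxA -yP mulmxK.
Qed.

(** The rank of A + B is at most the sum of the ranks, so C fills the whole of A + B, which contains
    A. *)
Lemma submx_of_rank_add m n (A B C : 'M[F]_(m, n)) :
  (C <= A + B)%MS -> \rank C = (\rank A + \rank B)%N -> (A <= C)%MS.
Proof.
move=> sub rk; apply: submx_trans (addsmxSl A B) _.
by rewrite -(geq_leqif (mxrank_leqif_sup sub)) rk mxrank_adds_leqif.
Qed.

(** Writing xy - 1 as x(y - 1) + (x - 1) compares row spaces, that is kernels on columns; writing it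
    as (x - 1)y + (y - 1) compares column spaces, after transposition. *)
Lemma rank_add_fixed n (x y : 'M[F]_n) :
  \rank (x *m y - 1%:M) = (\rank (x - 1%:M)%R + \rank (y - 1%:M)%R)%N ->
  (exists D, x - 1%:M = D *m (x *m y - 1%:M)) /\
  (exists D, x - 1%:M = (x *m y - 1%:M) *m D).
Proof.
move=> rk; split.
- apply/submxP; apply: submx_of_rank_add rk.
  have -> : x *m y - 1%:M = x *m (y - 1%:M) + (x - 1%:M).
    by rewrite mulmxBr mulmx1 addrA subrK.
  by rewrite addrC addmx_sub_adds ?submxMl.
- have : ((x - 1%:M)^T <= (x *m y - 1%:M)^T)%MS.
    apply: (@submx_of_rank_add _ _ _ (y - 1%:M)^T); last by rewrite !mxrank_tr.
    have -> : x *m y - 1%:M = (x - 1%:M) *m y + (y - 1%:M).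
      by rewrite mulmxBl mul1mx addrA subrK.
    by rewrite linearD /= trmx_mul addmx_sub_adds ?submxMl.
  case/submxP => D E; exists D^T.
  by rewrite -[LHS]trmxK E trmx_mul trmxK.
Qed.

(** The last row and column of [stab z - 1] vanish. A left multiple keeps the zero column and a
    right multiple the zero row, so [x - 1] lives in the upper left block. *)
Lemma stab_of_fixed n (z : 'M[F]_n) (x : 'M[F]_(n + 1)) D D' :
  x - 1%:M = D *m (stab z - 1%:M) -> x - 1%:M = (stab z - 1%:M) *m D' ->
  exists x0, x = stab x0.
Proof.
have szE : stab z - 1%:M = block_mx (z - 1%:M) 0 0 0.
  by rewrite (scalar_mx_block n 1 1) opp_block_mx add_block_mx !subr0 subrr.
rewrite szE -[D]submxK -[D']submxK !mulmx_block !mulmx0 !mul0mx !addr0 => E E'.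
have := E; rewrite E' => /eq_block_mx[_ ur _ _].
exists (ulsubmx x); move: E'; rewrite ur.
move/eqP; rewrite subr_eq (scalar_mx_block n 1 1) add_block_mx !addr0 !add0r => /eqP ->.
by rewrite block_mxKul.
Qed.

Lemma coeff_at_stab lam mu nu n (z : 'M[F]_n) :
  mnorm nu = (mnorm lam + mnorm mu)%N -> z \in unitmx -> has_modtype z nu ->
  coeff_at lam mu (stab z) = coeff_at lam mu z.
Proof.
move=> norm zu znu; rewrite !coeff_atE ?stab_unit //; congr Posz.
rewrite -(card_imset _ (@stab_inj F n)); apply: eq_card => x.
apply/idP/imsetP => [|[x0 + ->]]; last first.
  rewrite !inE stab_unit => /and3P[x0u /asboolP x0l /asboolP x0m].
  rewrite x0u stab_inv // -stabM /=; apply/andP; split; apply/asboolP; exact/has_modtype_stab.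
rewrite inE => /and3P[xu /asboolP xl /asboolP xm].
have xyE : x *m (invmx x *m stab z) = stab z by rewrite mulKVmx.
(* The three ranks are the norms of the modified types, so the norm hypothesis is exactly the
   additivity required. *)
have rk := rank_add_fixed (x := x) (y := invmx x *m stab z).
rewrite xyE !(has_modtype_rank xl, has_modtype_rank xm) in rk.
rewrite (has_modtype_rank (proj2 (has_modtype_stab _ _) znu)) in rk.
have [[D xD] [D' xD']] := rk norm.
have [x0 xE] := stab_of_fixed xD xD'; exists x0 => //; subst x.
move: xu xl xm; rewrite stab_unit => x0u; rewrite stab_inv // -stabM => xl xm.
rewrite inE x0u /=; apply/andP; split; apply/asboolP; exact/has_modtype_stab.
Qed.

Lemma coeff_at_same_type lam mu ka n m (y : 'M[F]_n) (z : 'M[F]_m) :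
  has_type y ka -> has_type z ka -> y \in unitmx -> z \in unitmx ->
  coeff_at lam mu y = coeff_at lam mu z.
Proof.
move=> [phi yi] [psi zi]; have e := module_iso_dim yi zi; subst m.
have [P uP] := module_iso_similar zi yi.
exact: coeff_at_conj.
Qed.

(** The parts equal to 1 come last in a partition, so their number is all that [pred_parts]
    forgets. *)
Lemma partition_pred_parts s : is_partition s ->
  s = [seq k.+1 | k <- pred_parts s] ++ nseq (count_mem 1%N s) 1%N.
Proof.
elim: s => //= x s IH; rewrite /is_partition /= => /andP[xs /andP[x0 s0]].
have sP : is_partition s by rewrite /is_partition (path_sorted xs).
rewrite /pred_parts /=; case: x xs x0 => // -[|x] xs _ /=; last first.
  by congr (_ :: _); apply: IH.
have s1 : s = nseq (size s) 1%N.
  apply/all_pred1P/allP => k ks /=; rewrite eqn_leq (allP s0) // andbT.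
  have /allP := order_path_min (fun y x z yx zy => leq_trans zy yx) xs; exact.
rewrite s1 [filter _ _](_ : _ = [::]) /=; first by rewrite count_nseq /= mul1n.
by elim: (size s).
Qed.

Lemma coeff_at_modtype lam mu nu m n (y : 'M[F]_m) (z : 'M[F]_n) :
  mnorm nu = (mnorm lam + mnorm mu)%N ->
  y \in unitmx -> z \in unitmx -> has_modtype y nu -> has_modtype z nu ->
  coeff_at lam mu y = coeff_at lam mu z.
Proof.
move=> norm.
(* Induction on the excess [k] of parts 1 at t - 1 in the type of [b]: each stabilization of [a]
   adds one such part and preserves the coefficient. At [k = 0] the types coincide. *)
have main k : forall p q (a : 'M[F]_p) (b : 'M[F]_q) al be,
    is_mpart al -> is_mpart be -> has_type a al -> has_type b be ->
    (forall f, f != 'X - 1 -> nu f = al f) -> (forall f, f != 'X - 1 -> nu f = be f) ->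
    nu ('X - 1) = pred_parts (al ('X - 1)) -> nu ('X - 1) = pred_parts (be ('X - 1)) ->
    count_mem 1%N (be ('X - 1)) = (count_mem 1%N (al ('X - 1)%R) + k)%N ->
    a \in unitmx -> b \in unitmx -> coeff_at lam mu a = coeff_at lam mu b.
  elim: k => [|k IH] p q a b al be alP beP aal bbe al_off be_off al1 be1 cnt au bu.
    have e : al = be.
      apply/fsfunP => f; case: (eqVneq f ('X - 1)) => [->|fX]; last by rewrite -al_off ?be_off.
      rewrite [LHS]partition_pred_parts; last by case: (alP ('X - 1)).
      by rewrite [RHS]partition_pred_parts -?al1 -?be1 ?cnt ?addn0 //; case: (beP ('X - 1)).
    by subst be; apply: coeff_at_same_type aal bbe au bu.
  rewrite -(coeff_at_stab norm au); last by exists al.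
  have [alP' ty'] := has_type_stab alP aal.
  apply: (IH _ _ _ _ _ _ alP' beP ty' bbe) => //; rewrite ?stab_unit //.
  - by move=> f fX; rewrite fsfun_withE (negPf fX) al_off.
  - by rewrite fsfun_with pred_parts_rcons1.
  - by rewrite fsfun_with cnt -cats1 count_cat /= addnS addn0 addn1.
move=> yu zu [al [alP yal al_off al1]] [be [beP zbe be_off be1]].
pose c (ka : mpart F) := count_mem 1%N (ka ('X - 1)).
have [le|/ltnW le] := leqP (c al) (c be).
  by apply: (main (c be - c al)%N _ _ _ _ al be); rewrite ?subnKC.
by symmetry; apply: (main (c al - c be)%N _ _ _ _ be al); rewrite ?subnKC.
Qed.

End Coefficient.

Unset Implicit Arguments.

Theorem theorem3p4 (F : finFieldType) (lam mu nu : mpart F) :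
  is_mpart lam -> is_mpart mu -> is_mpart nu ->
  mnorm nu = (mnorm lam + mnorm mu)%N ->
  exists a : nat,
    forall n : nat, (mnorm nu + size (epart nu) <= n)%N ->
    forall z : 'M[F]_n, z \in unitmx -> has_modtype z nu ->
      coeff_at lam mu z = a%:Z.
Proof.
move=> _ _ _ norm.
(* The constant is read off one reference element of any size, since [coeff_at_modtype] compares
   elements across sizes. If no size has an element of modified type [nu], the claim is vacuous and
   0 is an arbitrary choice. *)
have [[n [z [zu znu]]]|none] :=
    pselect (exists n (z : 'M[F]_n), z \in unitmx /\ has_modtype z nu).
  exists #|factorizations lam mu z| => m _ y yu ynu.
  by rewrite -coeff_atE //; apply: coeff_at_modtype norm _ _ ynu znu.
by exists 0%N => n _ z zu znu; case: none; exists n, z.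
Qed.
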